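(* For all non-bipartite graphs $\mathcal{G}$ and bipartite graphs $\mathcal{H}$, $V^0$ proves that there is no homomorphism from $\mathcal{G}$ to $\mathcal{H}$: $$V^0\vdash\forall\mathcal{G},\mathcal{H}\,\big(BIP(\mathcal{H})\wedge NONBIP(\mathcal{G})\to\neg HOM(\mathcal{G},\mathcal{H})\big).$$
   Context: $V^0$ is the two-sorted first-order theory over the vocabulary $\mathcal{L}^2_{PA}=\{0,1,+,\cdot,|\cdot|;=_1,=_2,\leq,\in\}$, with number variables (ranging over $\mathbb{N}$) and string (finite set) variables ranging over finite subsets of $\mathbb{N}$; $|X|$ denotes the least upper bound of $X$ and $X(t)$ abbreviates $t\in X$. $V^0$ is axiomatized by the standard basic axioms 2-BASIC and the comprehension scheme $\Sigma^B_0$-COMP: $\exists X\leq y\,\forall z<y\,(X(z)\leftrightarrow\varphi(z))$ for every formula $\varphi$ whose only quantifiers are bounded number quantifiers. A bounded string quantifier $\exists X\leq t$ means $\exists X(|X|\leq t\wedge\dots)$. Divisibility: $x|y\leftrightarrow\exists z\leq y\,(x\cdot z=y)$. The pairing function is $\langle x,y\rangle=(x+y)(x+y+1)+2y$, and $E(i,j)$ abbreviates $E(\langle i,j\rangle)$. A graph is a pair of strings $\mathcal{G}=(V_\mathcal{G},E_\mathcal{G})$ with $|V_\mathcal{G}|=n$ satisfying $\forall i<n\,V_\mathcal{G}(i)\wedge\forall i<j<n\,(E_\mathcal{G}(i,j)\leftrightarrow E_\mathcal{G}(j,i))\wedge\forall i<n\,\neg E_\mathcal{G}(i,i)$; quantification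 over graphs is over such pairs. $MAP(n,m,Z):\ \forall i<n\,\exists j<m\,Z(\langle i,j\rangle)\wedge\forall i<n\,\forall j_1,j_2<m\,(Z(\langle i,j_1\rangle)\wedge Z(\langle i,j_2\rangle)\to j_1=j_2)$. For graphs with $|V_\mathcal{G}|=n$, $|V_\mathcal{H}|=m$: $HOM(\mathcal{G},\mathcal{H}):\ \exists Z\leq\langle n-1,m-1\rangle\,\big(MAP(n,m,Z)\wedge\forall i_1,i_2<n\,\forall j_1,j_2<m\,(E_\mathcal{G}(i_1,i_2)\wedge Z(\langle i_1,j_1\rangle)\wedge Z(\langle i_2,j_2\rangle)\to E_\mathcal{H}(j_1,j_2))\big)$. $BIP(\mathcal{H}):\ \exists W_\mathcal{H},U_\mathcal{H}\leq m\,\big(\forall i<m\,(W_\mathcal{H}(i)\leftrightarrow\neg U_\mathcal{H}(i))\wedge\forall i<j<m\,(E_\mathcal{H}(i,j)\to(W_\mathcal{H}(i)\wedge U_\mathcal{H}(j))\vee(W_\mathcal{H}(j)\wedge U_\mathcal{H}(i)))\big)$. For a pair $\mathcal{C}_k=(V_{\mathcal{C}_k},E_{\mathcal{C}_k})$ with $|V_{\mathcal{C}_k}|=k$: $CYCLE(\mathcal{C}_k):\ E_{\mathcal{C}_k}(0,k-1)\wedge\forall i<k-1\,E_{\mathcal{C}_k}(i,i+1)\wedge\forall i,j<k-1\,(j\neq i+1\to\neg E_{\mathcal{C}_k}(i,j))$. $NONBIP(\mathcal{G}):\ \exists k\leq n\,\big(2|(k-1)\wedge\exists V_{\mathcal{C}_k}\,(|V_{\mathcal{C}_k}|=k)\,\exists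 E_{\mathcal{C}_k}\,(|E_{\mathcal{C}_k}|<4k^2)\,(CYCLE(V_{\mathcal{C}_k},E_{\mathcal{C}_k})\wedge HOM(\mathcal{C}_k,\mathcal{G}))\big)$. *)

(* Defs.v *)
From Stdlib Require Import List.
Import ListNotations.

(** * Two-sorted first-order syntax over [L^2_PA]

    Both sorts use de Bruijn indices, in two independent index spaces: a
    number binder leaves the string indices alone and vice versa.  The only
    string terms are variables, so a string term is just its index. *)

Inductive term : Type :=
| Var (i : nat)
| Zero
| One
| Add (t u : term)
| Mul (t u : term)
| Len (X : nat).

Inductive form : Type :=
| EqN (t u : term)
| EqS (X Y : nat)
| Le (t u : term)
| Mem (t : term) (X : nat)
| Bot
| Imp (A B : form)
| And (A B : form)
| Or (A B : form)
| AllN (A : form)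
| ExN (A : form)
| AllS (A : form)
| ExS (A : form).

Declare Scope term_scope.
Delimit Scope term_scope with term.
Bind Scope term_scope with term.
Declare Scope form_scope.
Delimit Scope form_scope with form.
Bind Scope form_scope with form.

Notation "0" := Zero : term_scope.
Notation "1" := One : term_scope.
Notation "2" := (Add 1 1)%term : term_scope.
Notation "4" := (Add (Add (Add 1 1) 1) 1)%term : term_scope.
Notation "t + u" := (Add t u) : term_scope.
Notation "t * u" := (Mul t u) : term_scope.
Notation "# i" := (Var i) (at level 1, format "# i") : term_scope.

Definition Not (A : form) : form := Imp A Bot.
Definition Iff (A B : form) : form := And (Imp A B) (Imp B A).
Definition Lt (t u : term) : form := And (Le t u) (Not (EqN t u)).

Notation "t = u" := (EqN t u) : form_scope.
Notation "t <> u" := (Not (EqN t u)) : form_scope.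
Notation "t <= u" := (Le t u) : form_scope.
Notation "t < u" := (Lt t u) : form_scope.
Notation "A /\ B" := (And A B) : form_scope.
Notation "A \/ B" := (Or A B) : form_scope.
Notation "~ A" := (Not A) : form_scope.
Notation "A ==> B" := (Imp A B) (at level 90, right associativity) : form_scope.
Notation "A <==> B" := (Iff A B) (at level 95, no associativity) : form_scope.

(** ** Substitution: [s] acts on number variables, [r] renames string variables *)

Fixpoint tsubst (s : nat -> term) (r : nat -> nat) (t : term) : term :=
  match t with
  | Var i => s i
  | Zero => Zero
  | One => One
  | Add t u => Add (tsubst s r t) (tsubst s r u)
  | Mul t u => Mul (tsubst s r t) (tsubst s r u)
  | Len X => Len (r X)
  end.

Definition scons {T : Type} (x : T) (f : nat -> T) (i : nat) : T :=
  match i with O => x | S j => f j end.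

Definition tshiftN : term -> term := tsubst (fun i => Var (S i)) (fun X => X).
Definition tshiftS : term -> term := tsubst Var S.

Fixpoint subst (s : nat -> term) (r : nat -> nat) (A : form) : form :=
  match A with
  | EqN t u => EqN (tsubst s r t) (tsubst s r u)
  | EqS X Y => EqS (r X) (r Y)
  | Le t u => Le (tsubst s r t) (tsubst s r u)
  | Mem t X => Mem (tsubst s r t) (r X)
  | Bot => Bot
  | Imp A B => Imp (subst s r A) (subst s r B)
  | And A B => And (subst s r A) (subst s r B)
  | Or A B => Or (subst s r A) (subst s r B)
  | AllN A => AllN (subst (scons (Var O) (fun i => tshiftN (s i))) r A)
  | ExN A => ExN (subst (scons (Var O) (fun i => tshiftN (s i))) r A)
  | AllS A => AllS (subst (fun i => tshiftS (s i)) (scons O (fun X => S (r X))) A)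
  | ExS A => ExS (subst (fun i => tshiftS (s i)) (scons O (fun X => S (r X))) A)
  end.

Definition shiftN : form -> form := subst (fun i => Var (S i)) (fun X => X).
Definition shiftS : form -> form := subst Var S.
Definition instN (t : term) : form -> form := subst (scons t Var) (fun X => X).
Definition instS (X : nat) : form -> form := subst Var (scons X (fun Y => Y)).

(** ** Bounded quantifiers

    The bound [t] lives outside the binder and is shifted here, while the body
    [A] lives under the binder. *)

Definition AllLe (t : term) (A : form) : form := AllN (#0 <= tshiftN t ==> A)%form.
Definition ExLe (t : term) (A : form) : form := ExN (#0 <= tshiftN t /\ A)%form.
Definition AllLt (t : term) (A : form) : form := AllN (#0 < tshiftN t ==> A)%form.
Definition ExLt (t : term) (A : form) : form := ExN (#0 < tshiftN t /\ A)%form.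
Definition ExSLe (t : term) (A : form) : form := ExS (Len 0 <= tshiftS t /\ A)%form.

(** * Provability: classical natural deduction with equality

    The open formulas of the theory [T] stand for their universal closures:
    axioms are usable in every context, and [AllNI], [AllSI] may generalize
    over their free variables. *)

Section Provability.
Variable T : form -> Prop.

Inductive prv : list form -> form -> Prop :=
| Ax G A : T A -> prv G A
| Hyp G A : In A G -> prv G A
| ImpI G A B : prv (A :: G) B -> prv G (Imp A B)
| ImpE G A B : prv G (Imp A B) -> prv G A -> prv G B
| AndI G A B : prv G A -> prv G B -> prv G (And A B)
| AndE1 G A B : prv G (And A B) -> prv G A
| AndE2 G A B : prv G (And A B) -> prv G B
| OrI1 G A B : prv G A -> prv G (Or A B)
| OrI2 G A B : prv G B -> prv G (Or A B)
| OrE G A B C : prv G (Or A B) -> prv (A :: G) C -> prv (B :: G) C -> prv G C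
| RAA G A : prv (Not A :: G) Bot -> prv G A
| AllNI G A : prv (map shiftN G) A -> prv G (AllN A)
| AllNE G A t : prv G (AllN A) -> prv G (instN t A)
| ExNI G A t : prv G (instN t A) -> prv G (ExN A)
| ExNE G A B : prv G (ExN A) -> prv (A :: map shiftN G) (shiftN B) -> prv G B
| AllSI G A : prv (map shiftS G) A -> prv G (AllS A)
| AllSE G A X : prv G (AllS A) -> prv G (instS X A)
| ExSI G A X : prv G (instS X A) -> prv G (ExS A)
| ExSE G A B : prv G (ExS A) -> prv (A :: map shiftS G) (shiftS B) -> prv G B
| EqNRefl G t : prv G (EqN t t)
| EqNSubst G A t u : prv G (EqN t u) -> prv G (instN t A) -> prv G (instN u A)
| EqSRefl G X : prv G (EqS X X)
| EqSSubst G A X Y : prv G (EqS X Y) -> prv G (instS X A) -> prv G (instS Y A).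

Definition provable (A : form) : Prop := prv [] A.

End Provability.

(** * The theory [V^0] *)

Inductive Sigma0B : form -> Prop :=
| Sigma0B_EqN t u : Sigma0B (EqN t u)
| Sigma0B_EqS X Y : Sigma0B (EqS X Y)
| Sigma0B_Le t u : Sigma0B (Le t u)
| Sigma0B_Mem t X : Sigma0B (Mem t X)
| Sigma0B_Bot : Sigma0B Bot
| Sigma0B_Imp A B : Sigma0B A -> Sigma0B B -> Sigma0B (Imp A B)
| Sigma0B_And A B : Sigma0B A -> Sigma0B B -> Sigma0B (And A B)
| Sigma0B_Or A B : Sigma0B A -> Sigma0B B -> Sigma0B (Or A B)
| Sigma0B_AllLe t A : Sigma0B A -> Sigma0B (AllLe t A)
| Sigma0B_ExLe t A : Sigma0B A -> Sigma0B (ExLe t A)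
| Sigma0B_AllLt t A : Sigma0B A -> Sigma0B (AllLt t A)
| Sigma0B_ExLt t A : Sigma0B A -> Sigma0B (ExLt t A).

(** 2-BASIC as in Cook and Nguyen, "Logical Foundations of Proof Complexity",
    with [x := #0], [y := #1] and the strings [X := 0], [Y := 1].  By [L1] and
    [L2], [|X|] is one more than the maximum of a nonempty [X]. *)
Inductive Basic2 : form -> Prop :=
| B1 : Basic2 (#0 + 1 <> 0)
| B2 : Basic2 (#0 + 1 = #1 + 1 ==> #0 = #1)
| B3 : Basic2 (#0 + 0 = #0)
| B4 : Basic2 (#0 + (#1 + 1) = (#0 + #1) + 1)
| B5 : Basic2 (#0 * 0 = 0)
| B6 : Basic2 (#0 * (#1 + 1) = (#0 * #1) + #0)
| B7 : Basic2 (#0 <= #1 /\ #1 <= #0 ==> #0 = #1)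
| B8 : Basic2 (#0 <= #0 + #1)
| B9 : Basic2 (0 <= #0)
| B10 : Basic2 (#0 <= #1 \/ #1 <= #0)
| B11 : Basic2 (#0 <= #1 <==> #0 < #1 + 1)
| B12 : Basic2 (#0 <> 0 ==> ExLe #0 (#0 + 1 = #1))
| L1 : Basic2 (Mem #1 0 ==> #1 < Len 0)
| L2 : Basic2 (#1 + 1 = Len 0 ==> Mem #1 0)
| SE : Basic2 (Len 0 = Len 1 /\ AllLt (Len 0) (Mem #0 0 <==> Mem #0 1) ==> EqS 0 1).

(** In [COMP y A], [#0] is the variable [z] of [A] and [#(S i)] is the ambient
    number variable [i]; shifting [A] makes the comprehended set not free in it. *)
Definition COMP (y : nat) (A : form) : form :=
  ExSLe #y (AllLt #y (Mem #0 0 <==> shiftS A)).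

Inductive V0 : form -> Prop :=
| V0_basic A : Basic2 A -> V0 A
| V0_comp y A : Sigma0B A -> V0 (COMP y A).

(** * Graphs

    Number parameters are terms and string parameters are indices, all taken in
    the context in which the formula is used. *)

Definition divides (t u : term) : form := ExLe u (tshiftN t * #0 = tshiftN u).

(** The language has no subtraction: [LetPred t A] is [A(t - 1)], with [#0]
    standing for [t - 1] in [A] and the usual convention [0 - 1 = 0]. *)
Definition LetPred (t : term) (A : form) : form :=
  ExLe t ((#0 + 1 = tshiftN t \/ (tshiftN t = 0 /\ #0 = 0)) /\ A).

Definition tpair (t u : term) : term := (t + u) * (t + u + 1) + 2 * u.
Definition Rel (Z : nat) (t u : term) : form := Mem (tpair t u) Z.

Definition GRAPH (V E : nat) : form :=
  AllLt (Len V) (Mem #0 V)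
  /\ AllLt (Len V) (AllLt #0 (Rel E #0 #1 <==> Rel E #1 #0))
  /\ AllLt (Len V) (~ Rel E #0 #0).

Definition MAP (n m : term) (Z : nat) : form :=
  AllLt n (ExLt (tshiftN m) (Rel Z #1 #0))
  /\ AllLt n (AllLt (tshiftN m) (AllLt (tshiftN (tshiftN m))
       (Rel Z #2 #1 /\ Rel Z #2 #0 ==> #1 = #0))).

(** Under the binders of the last clause, [i1, i2, j1, j2] are [#3, #2, #1, #0].
    The bound on [Z] is [<n - 1, m - 1>], with [n - 1 = #1] and [m - 1 = #0]. *)
Definition HOM (VG EG VH EH : nat) : form :=
  LetPred (Len VG) (LetPred (Len VH) (ExSLe (tpair #1 #0)
    (let VG := S VG in let EG := S EG in
     let VH := S VH in let EH := S EH in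
     MAP (Len VG) (Len VH) 0
     /\ AllLt (Len VG) (AllLt (Len VG) (AllLt (Len VH) (AllLt (Len VH)
          (Rel EG #3 #2 /\ Rel 0 #3 #1 /\ Rel 0 #2 #0 ==> Rel EH #1 #0))))))).

(** [W] and [U] are the strings [1] and [0] inside the two string quantifiers;
    in the last clause [j = #1] and [i = #0]. *)
Definition BIP (V E : nat) : form :=
  ExSLe (Len V) (ExSLe (Len (S V))
    (let V := S (S V) in let E := S (S E) in
     AllLt (Len V) (Mem #0 1 <==> ~ Mem #0 0)
     /\ AllLt (Len V) (AllLt #0
          (Rel E #0 #1 ==>
             (Mem #0 1 /\ Mem #1 0) \/ (Mem #1 1 /\ Mem #0 0))))).

(** [k - 1] is [#0], then [#1] under one and [#2] under two more binders; in
    the last clause [i = #1] and [j = #0]. *)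
Definition CYCLE (V E : nat) : form :=
  LetPred (Len V)
    (Rel E 0 #0
     /\ AllLt #0 (Rel E #0 (#0 + 1))
     /\ AllLt #0 (AllLt #1 (#0 <> #1 + 1 ==> ~ Rel E #1 #0))).

(** [k] is [#0]; inside the string quantifiers the cycle is the pair [1, 0].
    It is not required to satisfy [GRAPH], which [CYCLE] would contradict for
    [k >= 3]. *)
Definition NONBIP (V E : nat) : form :=
  ExLe (Len V)
    (LetPred #0 (divides 2 #0)
     /\ ExS (Len 0 = #0
        /\ ExS (Len 0 < 4 * (#0 * #0)
           /\ CYCLE 1 0
           /\ HOM 1 0 (S (S V)) (S (S E))))).

(** Quantification over a graph binds its vertex string as [1] and its edge
    string as [0]. *)
Definition AllGraph (A : form) : form := AllS (AllS (GRAPH 1 0 ==> A)).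

(* Main.v *)
(** V^0 proves induction for a [Sigma0B] formula [A]: comprehension below [b]
    gives the set of all [z < b] with [A] true up to [z], and by [L1] and [L2]
    its length locates the first failure of [A].

    Let [Z1 : C_k -> G] and [Z2 : G -> H] be homomorphisms and [W] a colour
    class of [H].  Every vertex of [C_k] has an image in [H] along [Z1] and [Z2],
    and images of adjacent vertices have different colours.  Fix an image [l0]
    of [0].  By induction on [q], if [2 q <= k - 1] then the vertex [2 q] has an
    image of the same colour as [l0]; at [2 q = k - 1] this contradicts the edge
    [(0, k - 1)].  The bound [|E| < 4 k^2] excludes [k = 0]. *)

From Stdlib Require Import List.
Import ListNotations.
Require Import Defs.

(** * Substitution calculus *)

Lemma tsubst_ext s s' r r' t :
  (forall i, s i = s' i) -> (forall X, r X = r' X) ->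
  tsubst s r t = tsubst s' r' t.
Proof. intros Hs Hr; induction t; cbn; congruence. Qed.

Lemma tsubst_tsubst s r s' r' t :
  tsubst s' r' (tsubst s r t)
  = tsubst (fun i => tsubst s' r' (s i)) (fun X => r' (r X)) t.
Proof. induction t; cbn; congruence. Qed.

Lemma tsubst_id s r t :
  (forall i, s i = Var i) -> (forall X, r X = X) -> tsubst s r t = t.
Proof. intros Hs Hr; induction t; cbn; congruence. Qed.

Lemma subst_ext A : forall s s' r r',
  (forall i, s i = s' i) -> (forall X, r X = r' X) ->
  subst s r A = subst s' r' A.
Proof.
  induction A; cbn; intros s s' r r' Hs Hr; f_equal;
    rewrite ?Hr; auto using tsubst_ext.
  all: match goal with IH : context [subst _ _ ?A = _] |- subst _ _ ?A = _ =>
         apply IH end.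
  all: intros [|i]; cbn; rewrite ?Hs, ?Hr; reflexivity.
Qed.

Lemma subst_subst A : forall s r s' r',
  subst s' r' (subst s r A)
  = subst (fun i => tsubst s' r' (s i)) (fun X => r' (r X)) A.
Proof.
  induction A; cbn; intros s r s' r'; f_equal;
    rewrite ?tsubst_tsubst; auto.
  all: match goal with IH : context [subst _ _ (subst _ _ ?A)]
                       |- context [subst _ _ (subst _ _ ?A)] => rewrite IH end.
  all: apply subst_ext; intros [|i]; cbn; unfold tshiftN, tshiftS;
    rewrite ?tsubst_tsubst; try reflexivity; apply tsubst_ext; reflexivity.
Qed.

Lemma tsubst_scons_tshiftN u t :
  tsubst (scons u Var) (fun X => X) (tshiftN t) = t.
Proof.
  unfold tshiftN; rewrite tsubst_tsubst; apply tsubst_id; reflexivity.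
Qed.

(** Comprehension is applied to a renamed copy of the induction formula. A bounded quantifier stays
    bounded because substitution commutes with the shift of its bound. *)
Lemma Sigma0B_subst A : Sigma0B A -> forall s r, Sigma0B (subst s r A).
Proof.
  assert (Hup : forall s r t, tsubst (scons #0%term (fun i => tshiftN (s i))) r
                  (tshiftN t) = tshiftN (tsubst s r t)).
  { intros s r t; unfold tshiftN; rewrite !tsubst_tsubst; reflexivity. }
  induction 1; intros s r; try (constructor; auto; fail);
    unfold AllLe, ExLe, AllLt, ExLt, Lt, Not; cbn [subst tsubst scons];
    rewrite Hup.
  - apply Sigma0B_AllLe; auto.
  - apply Sigma0B_ExLe; auto.
  - apply Sigma0B_AllLt; auto.
  - apply Sigma0B_ExLt; auto.
Qed.

(** * Weakening of contexts *)

Section Weakening.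
Variable T : form -> Prop.

Lemma prv_weaken G A : prv T G A -> forall G', incl G G' -> prv T G' A.
Proof.
  induction 1; intros G' HG;
    pose proof (fun f : form -> form => incl_map f HG) as HGmap;
    try (econstructor; eauto using incl_cons, in_eq, incl_tl; fail).
Qed.

Lemma prv_weaken1 G A B : prv T G A -> prv T (B :: G) A.
Proof. intros H; eapply prv_weaken; [exact H | apply incl_tl, incl_refl]. Qed.

End Weakening.

(** * Tactics for derivations inside the calculus *)

Ltac hyp := apply Hyp; cbn; repeat (first [left; reflexivity | right]).

Ltac incl_ctx := intros ?; cbn; tauto.

(** Matching is up to conversion, so conjunctions hidden in [Lt], [Iff], [GRAPH] or [MAP] are split
    as well. *)
Ltac from H :=
  first [ exact H | from (AndE1 _ _ _ _ H) | from (AndE2 _ _ _ _ H) ].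

Ltac conj_hyp :=
  lazymatch goal with
  | |- prv ?T (?B :: ?G) _ =>
      first [ from (Hyp T (B :: G) B (in_eq B G))
            | apply prv_weaken1; conj_hyp ]
  end.

Ltac have H A :=
  lazymatch goal with |- prv ?T ?G _ => assert (H : prv T G A) by conj_hyp end.

Ltac inst H t :=
  apply (AllNE _ _ _ t) in H; unfold instN in H; cbn in H.

Ltac discharge H :=
  lazymatch type of H with prv ?T ?G (Imp ?A _) =>
    let HA := fresh in
    assert (HA : prv T G A);
    [ try conj_hyp | apply (ImpE _ _ _ _ H) in HA; clear H; rename HA into H ]
  end.

Ltac open_ex H := eapply ExNE with (1 := H); clear H; cbn.

Ltac open_exS H := eapply ExSE with (1 := H) (B := Bot); clear H; cbn.

(** In [LetPred] and in the bounded existential quantifiers the body is the last conjunct, which is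
    what this extracts. *)
Ltac head_conj H :=
  lazymatch goal with |- prv _ (?A :: _) _ =>
    let rec go A := lazymatch A with And _ ?B => go B | _ => have H A end in
    go A end.

(** * Derived rules for connectives and equality *)

Section DerivedRules.
Variable T : form -> Prop.

Lemma prv_cut G A B : prv T G A -> prv T (A :: G) B -> prv T G B.
Proof. intros HA HB; eapply ImpE; [apply ImpI, HB | exact HA]. Qed.

(** Transfers a derivation from a small explicit context to any context that derives its
    hypotheses. *)
Lemma prv_cuts D : forall G A,
  prv T D A -> (forall B, In B D -> prv T G B) -> prv T G A.
Proof.
  induction D as [|B D IH]; intros G A HA HD.
  - eapply prv_weaken; [exact HA | intros x []].
  - eapply ImpE; [| apply (HD B), in_eq].
    apply IH; [apply ImpI, HA | intros; apply HD; right; assumption].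
Qed.

Lemma prv_exfalso G A : prv T G Bot -> prv T G A.
Proof. intros H; apply RAA, prv_weaken1, H. Qed.

(** If [B] failed, the first case would refute [A], and then the second would yield [B]. *)
Lemma prv_cases G A B : prv T (A :: G) B -> prv T (Not A :: G) B -> prv T G B.
Proof.
  intros H1 H2.
  assert (HA : prv T (Not B :: G) (Not A)).
  { apply ImpI. apply ImpE with B.
    - apply Hyp; right; left; reflexivity.
    - eapply prv_weaken; [exact H1|].
      apply incl_cons; [apply in_eq | do 2 apply incl_tl; apply incl_refl]. }
  apply RAA. apply ImpE with B; [apply Hyp, in_eq |].
  apply prv_cut with (1 := HA). eapply prv_weaken; [exact H2|].
  apply incl_cons; [apply in_eq | do 2 apply incl_tl; apply incl_refl].
Qed.

(** Two colour changes cancel. *)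
Lemma Iff_not_trans G A B C :
  prv T G (Iff A (Not B)) -> prv T G (Iff B (Not C)) -> prv T G (Iff A C).
Proof.
  intros H1 H2; apply AndI; apply ImpI.
  - apply RAA. apply ImpE with B.
    + apply ImpE with A; [| apply Hyp; cbn; auto].
      do 2 apply prv_weaken1. apply AndE1 with (1 := H1).
    + apply ImpE with (Not C); [| apply Hyp; cbn; auto].
      do 2 apply prv_weaken1. apply AndE2 with (1 := H2).
  - apply ImpE with (Not B); [apply prv_weaken1, (AndE2 _ _ _ _ H1) |].
    apply ImpI. apply ImpE with C; [| apply Hyp; cbn; auto].
    apply ImpE with B; [| apply Hyp; cbn; auto].
    do 2 apply prv_weaken1. apply AndE1 with (1 := H2).
Qed.

Lemma Iff_not_absurd G A B :
  prv T G (Iff A B) -> prv T G (Iff B (Not A)) -> prv T G Bot.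
Proof.
  intros H1 H2.
  assert (HA : prv T G (Not A)).
  { apply ImpI.
    assert (HB : prv T (A :: G) B).
    { apply ImpE with A; [apply prv_weaken1, (AndE1 _ _ _ _ H1) |].
      apply Hyp, in_eq. }
    apply ImpE with A; [| apply Hyp, in_eq].
    apply ImpE with B; [| exact HB].
    apply prv_weaken1, (AndE1 _ _ _ _ H2). }
  apply ImpE with (1 := HA).
  apply ImpE with (1 := AndE2 _ _ _ _ H1).
  apply ImpE with (1 := AndE2 _ _ _ _ H2). exact HA.
Qed.

Lemma Iff_not_sym G A B : prv T G (Iff A (Not B)) -> prv T G (Iff B (Not A)).
Proof.
  intros H; apply AndI; apply ImpI.
  - apply ImpI. apply ImpE with B; [| hyp].
    apply ImpE with A; [| hyp]. do 2 apply prv_weaken1. exact (AndE1 _ _ _ _ H).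
  - apply RAA. apply ImpE with A; [hyp |].
    apply ImpE with (Not B); [| hyp]. do 2 apply prv_weaken1.
    exact (AndE2 _ _ _ _ H).
Qed.

Lemma Iff_trans G A B C :
  prv T G (Iff A B) -> prv T G (Iff B C) -> prv T G (Iff A C).
Proof.
  intros H1 H2; apply AndI; apply ImpI; apply ImpE with B.
  - apply prv_weaken1. exact (AndE1 _ _ _ _ H2).
  - apply ImpE with A; [apply prv_weaken1, (AndE1 _ _ _ _ H1) | hyp].
  - apply prv_weaken1. exact (AndE2 _ _ _ _ H1).
  - apply ImpE with C; [apply prv_weaken1, (AndE2 _ _ _ _ H2) | hyp].
Qed.

(** Turns the edge clause of [BIP] into a statement about one colour class: [A], [B] say that the
    two ends lie in [W], and [A'], [B'] that they lie in [U]. *)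
Lemma Iff_not_of_split G A A' B B' :
  prv T G (Iff A (Not A')) -> prv T G (Iff B (Not B')) ->
  prv T G (Or (And A B') (And B A')) -> prv T G (Iff A (Not B)).
Proof.
  intros HA HB H. eapply OrE with (1 := H); clear H; apply AndI; apply ImpI.
  - apply ImpI. apply ImpE with B'; [| conj_hyp].
    apply ImpE with B; [| hyp]. do 3 apply prv_weaken1. exact (AndE1 _ _ _ _ HB).
  - conj_hyp.
  - apply prv_exfalso. apply ImpE with A'; [| conj_hyp].
    apply ImpE with A; [| hyp]. do 2 apply prv_weaken1. exact (AndE1 _ _ _ _ HA).
  - apply prv_exfalso. apply ImpE with B; [hyp | conj_hyp].
Qed.

Lemma eq_sym G t u : prv T G (t = u)%form -> prv T G (u = t)%form.
Proof.
  intros H. pose proof (EqNSubst T G (#0 = tshiftN t)%form t u H) as H1.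
  cbn in H1; rewrite !tsubst_scons_tshiftN in H1. apply H1, EqNRefl.
Qed.

Lemma eq_trans G t u v :
  prv T G (t = u)%form -> prv T G (u = v)%form -> prv T G (t = v)%form.
Proof.
  intros H1 H2. pose proof (EqNSubst T G (tshiftN t = #0)%form u v H2) as H.
  cbn in H; rewrite !tsubst_scons_tshiftN in H. apply H, H1.
Qed.

Lemma eq_le_l G t u v :
  prv T G (t = u)%form -> prv T G (t <= v)%form -> prv T G (u <= v)%form.
Proof.
  intros H. pose proof (EqNSubst T G (#0 <= tshiftN v)%form t u H) as H1.
  cbn in H1; rewrite !tsubst_scons_tshiftN in H1. exact H1.
Qed.

Lemma eq_le_r G t u v :
  prv T G (t = u)%form -> prv T G (v <= t)%form -> prv T G (v <= u)%form.
Proof.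
  intros H. pose proof (EqNSubst T G (tshiftN v <= #0)%form t u H) as H1.
  cbn in H1; rewrite !tsubst_scons_tshiftN in H1. exact H1.
Qed.

Lemma eq_lt_r G t u v :
  prv T G (t = u)%form -> prv T G (v < t)%form -> prv T G (v < u)%form.
Proof.
  intros H. pose proof (EqNSubst T G (tshiftN v < #0)%form t u H) as H1.
  cbn in H1; rewrite !tsubst_scons_tshiftN in H1. exact H1.
Qed.

End DerivedRules.

(** * Order in [V0] from 2-BASIC *)

(** An axiom is available in every context, so its free variables can be generalized even when [G]
    mentions them, and then instantiated. *)
Lemma basic_inst G A t u X :
  Basic2 A ->
  prv V0 G (subst (scons t (scons u Var)) (scons X (fun Y => Y)) A).
Proof.
  intros HA.
  assert (H : prv V0 G (AllN (AllN (AllS A)))).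
  { apply AllNI, AllNI, AllSI, Ax, V0_basic, HA. }
  apply AllNE with (t := u) in H; cbn in H.
  apply AllNE with (t := t) in H; cbn in H.
  apply AllSE with (X := X) in H; unfold instS in H.
  rewrite !subst_subst in H.
  erewrite subst_ext; [exact H | |].
  - intros [|[|i]]; cbn; unfold tshiftN, tshiftS; rewrite ?tsubst_tsubst;
      cbn; try reflexivity; symmetry; apply tsubst_id; reflexivity.
  - intros [|Y]; reflexivity.
Qed.

Lemma le_refl G t : prv V0 G (t <= t)%form.
Proof.
  eapply OrE; [exact (basic_inst G _ t t 0 B10) | |]; apply Hyp, in_eq.
Qed.

Lemma le_antisym G t u :
  prv V0 G (t <= u)%form -> prv V0 G (u <= t)%form -> prv V0 G (t = u)%form.
Proof.
  intros H1 H2. eapply ImpE; [exact (basic_inst G _ t u 0 B7) |].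
  apply AndI; assumption.
Qed.

Lemma lt_succ_of_le G t u : prv V0 G (t <= u)%form -> prv V0 G (t < u + 1)%form.
Proof. apply ImpE, (AndE1 _ _ _ _ (basic_inst G _ t u 0 B11)). Qed.

Lemma le_of_lt_succ G t u : prv V0 G (t < u + 1)%form -> prv V0 G (t <= u)%form.
Proof. apply ImpE, (AndE2 _ _ _ _ (basic_inst G _ t u 0 B11)). Qed.

Lemma lt_irrefl G t : prv V0 G (t < t)%form -> prv V0 G Bot.
Proof. intros H; eapply ImpE; [exact (AndE2 _ _ _ _ H) | apply EqNRefl]. Qed.

Lemma lt_of_succ_le G t u : prv V0 G (t + 1 <= u)%form -> prv V0 G (t < u)%form.
Proof.
  intros H. apply AndI.
  - eapply OrE; [exact (basic_inst G _ t u 0 B10) | apply Hyp, in_eq |].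
    cbn. apply prv_exfalso.
    assert (Hlt : prv V0 ((u <= t)%form :: G) (u < t + 1)%form).
    { apply lt_succ_of_le, Hyp, in_eq. }
    eapply ImpE; [exact (AndE2 _ _ _ _ Hlt) |].
    apply le_antisym; [exact (AndE1 _ _ _ _ Hlt) | apply prv_weaken1, H].
  - apply ImpI. set (G' := _ :: G).
    assert (Hlt : prv V0 G' (t < t + 1)%form) by apply lt_succ_of_le, le_refl.
    eapply ImpE; [exact (AndE2 _ _ _ _ Hlt) |].
    apply le_antisym; [exact (AndE1 _ _ _ _ Hlt) |].
    apply eq_le_r with u; [apply eq_sym, Hyp, in_eq | apply prv_weaken1, H].
Qed.

(** B10 leaves the case [u <= t + 1]; unless [u = t + 1], B11 lowers this to [u <= t], against
    [t < u]. *)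
Lemma succ_le_of_lt G t u : prv V0 G (t < u)%form -> prv V0 G (t + 1 <= u)%form.
Proof.
  intros H.
  eapply OrE; [exact (basic_inst G _ (t + 1) u 0 B10) | apply Hyp, in_eq |].
  cbn. apply prv_cases with (u = t + 1)%form.
  - apply eq_le_l with u; [apply Hyp, in_eq | apply le_refl].
  - set (G' := _ :: _).
    assert (H' : prv V0 G' (t < u)%form) by (do 2 apply prv_weaken1; exact H).
    apply prv_exfalso. eapply ImpE; [exact (AndE2 _ _ _ _ H') |].
    apply le_antisym; [exact (AndE1 _ _ _ _ H') |].
    apply le_of_lt_succ, AndI; apply Hyp; cbn; auto.
Qed.

Lemma le_0_eq G t : prv V0 G (t <= 0)%form -> prv V0 G (t = 0)%form.
Proof.
  intros H; apply le_antisym; [exact H | exact (basic_inst G _ t t 0 B9)].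
Qed.

Lemma le_cases G t u A :
  prv V0 G (t <= u)%form ->
  prv V0 ((t = u)%form :: G) A -> prv V0 ((t < u)%form :: G) A -> prv V0 G A.
Proof.
  intros Hle Heq Hlt. apply prv_cases with (t = u)%form; [exact Heq |].
  apply prv_cut with (t < u)%form.
  - apply AndI; [apply prv_weaken1, Hle | apply Hyp, in_eq].
  - eapply prv_weaken; [exact Hlt |].
    apply incl_cons; [apply in_eq | do 2 apply incl_tl; apply incl_refl].
Qed.

Lemma lt_trichotomy G t u A :
  prv V0 ((t < u)%form :: G) A -> prv V0 ((t = u)%form :: G) A ->
  prv V0 ((u < t)%form :: G) A -> prv V0 G A.
Proof.
  intros H1 H2 H3.
  eapply OrE; [exact (basic_inst _ _ t u 0 B10) | |]; cbn.
  - apply le_cases with t u; [hyp | |].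
    + eapply prv_weaken; [exact H2 |]. incl_ctx.
    + eapply prv_weaken; [exact H1 |]. incl_ctx.
  - apply le_cases with u t; [hyp | |].
    + apply prv_cut with (t = u)%form; [apply eq_sym; hyp |].
      eapply prv_weaken; [exact H2 |]. incl_ctx.
    + eapply prv_weaken; [exact H3 |]. incl_ctx.
Qed.

Lemma lt_0_absurd G t : prv V0 G (t < 0)%form -> prv V0 G Bot.
Proof.
  intros H. apply ImpE with (1 := AndE2 _ _ _ _ H).
  apply le_0_eq, (AndE1 _ _ _ _ H).
Qed.

(** * Induction from comprehension *)

(* In [at_ A n u] the induction variable of [A] is [u], the other number
   variables lie under [n] binders and the strings under one. *)
Definition at_ (A : form) (n : nat) (u : term) : form :=
  subst (scons u (fun i => Var (n + i))) S A.

(** Shifts and instantiations only change the binder count and the argument, so [A] itself stays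
    folded throughout the induction proof. *)
Lemma subst_at A n m s u :
  (forall i, s (n + i) = Var (m + i)) ->
  subst s (fun X => X) (at_ A n u) = at_ A m (tsubst s (fun X => X) u).
Proof.
  intros Hs; unfold at_; rewrite subst_subst; apply subst_ext; [| reflexivity].
  intros [|i]; [reflexivity | apply Hs].
Qed.

Lemma eq_at G A n t u :
  prv V0 G (t = u)%form -> prv V0 G (at_ A n t) -> prv V0 G (at_ A n u).
Proof.
  intros H. pose proof (EqNSubst V0 G (at_ A (S n) #0) t u H) as H1.
  unfold instN in H1; rewrite !subst_at with (m := n) in H1 by reflexivity.
  exact H1.
Qed.

(** A number up to [t + 1] is either [t + 1] or, by B11, at most [t]. The comprehended set collects
    the [z] up to which [A] holds, so this moves membership one step up. *)
Lemma AllLe_at_succ A n t :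
  prv V0 [AllLe t (at_ A (S n) #0); at_ A n (t + 1)]
    (AllLe (t + 1) (at_ A (S n) #0)).
Proof.
  apply AllNI, ImpI. cbn [map].
  apply le_cases with #0%term (tshiftN t + 1)%term; [hyp | |].
  - apply eq_at with (tshiftN t + 1)%term; [apply eq_sym; hyp |].
    apply Hyp; do 3 right; left. now apply subst_at.
  - set (G := _ :: _).
    assert (H : prv V0 G (AllLe (tshiftN t) (at_ A (S (S n)) #0))).
    { apply Hyp; do 2 right; left. cbn.
      rewrite subst_at with (m := S (S n)) by reflexivity.
      unfold AllLe, tshiftN; do 2 f_equal. rewrite !tsubst_tsubst. reflexivity. }
    apply AllNE with (t := #0%term) in H. unfold instN in H; cbn in H.
    rewrite tsubst_scons_tshiftN, subst_at with (m := S n) in H by reflexivity.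
    apply ImpE with (1 := H). apply le_of_lt_succ; hyp.
Qed.

(* Here [#0] is the number [b] with [~ A(b)], and the string [0] is the
   comprehended set. *)
Lemma induction_core A :
  prv V0
    [(Len 0 <= #0 /\ AllLt #0 (Mem #0 0 <==> AllLe #0 (at_ A 3 #0)))%form;
     Not (at_ A 1 #0); at_ A 1 0; AllN (at_ A 2 #0 ==> at_ A 2 (#0 + 1))]
    Bot.
Proof.
  set (G := _ :: _).
  assert (Hset : prv V0 G (AllLt #0 (Mem #0 0 <==> AllLe #0 (at_ A 3 #0))))
    by (eapply AndE2; hyp).
  (* Comprehension decides membership only below [b], so [0 < b] is needed before 0 can be placed in
     the set. *)
  assert (Hb : prv V0 G (0 < #0)%form).
  { apply le_cases with 0%term #0%term.
    - exact (basic_inst G _ #0%term #0%term 0 B9).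
    - apply prv_exfalso. apply ImpE with (at_ A 1 #0); [hyp |].
      apply eq_at with 0%term; hyp.
    - hyp. }
  assert (H0 : prv V0 G (Mem 0 0)).
  { pose proof (ImpE _ _ _ _ (AllNE _ _ _ 0%term Hset) Hb) as H.
    apply ImpE with (1 := AndE2 _ _ _ _ H). clear H.
    change (subst _ _ (AllLe #0 (at_ A 3 #0)))
      with (AllLe 0 (subst (scons #0%term (fun i => tshiftN (scons 0%term Var i)))
                       (fun X => X) (at_ A 3 #0))).
    rewrite subst_at with (m := 2) by reflexivity.
    apply AllNI, ImpI. apply eq_at with 0%term.
    - apply eq_sym, le_0_eq; hyp.
    - apply Hyp; right; right; right; left. now apply subst_at. }
  (* As 0 is in the set, L1 makes its length positive. B12 then supplies [x] with [x + 1] equal to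
     the length, and L2 puts [x] into the set. *)
  assert (Hpred : prv V0 G (ExLe (Len 0) (#0 + 1 = Len 0)%form)).
  { apply ImpE with (1 := basic_inst G _ (Len 0) 0%term 0 B12).
    apply ImpI. apply lt_irrefl with 0%term.
    apply eq_lt_r with (Len 0); [hyp |]. apply prv_weaken1.
    apply ImpE with (1 := basic_inst G _ 0%term 0%term 0 L1). exact H0. }
  eapply ExNE with (1 := Hpred).
  set (G' := _ :: _). change (prv V0 G' Bot).
  assert (Hlen : prv V0 G' (#0 + 1 = Len 0)%form) by (eapply AndE2; hyp).
  assert (Hle : prv V0 G' (#0 + 1 <= #1)%form).
  { apply eq_le_l with (Len 0); [apply eq_sym, Hlen |].
    eapply AndE1; apply Hyp; right; left; reflexivity. }
  assert (Hset' : prv V0 G' (AllLt #1 (Mem #0 0 <==> AllLe #0 (at_ A 4 #0)))).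
  { eapply AndE2; apply Hyp; right; left. cbn.
    rewrite subst_at with (m := 4) by reflexivity. reflexivity. }
  assert (Hinst : forall t, prv V0 G' (t < #1 ==>
            (Mem t 0 <==> AllLe t (at_ A 3 #0)))%form).
  { intros t. pose proof (AllNE _ _ _ t Hset') as H.
    unfold instN in H; cbn in H.
    rewrite subst_at with (m := 3) in H by reflexivity. exact H. }
  assert (Hx : prv V0 G' (AllLe #0 (at_ A 3 #0))).
  { apply ImpE with (Mem #0 0).
    - eapply AndE1, ImpE; [apply (Hinst #0%term) | apply lt_of_succ_le, Hle].
    - apply ImpE with (1 := basic_inst G' _ 0%term #0%term 0 L2). exact Hlen. }
  assert (Hsucc : prv V0 G' (at_ A 2 (#0 + 1))).
  { pose proof (ImpE _ _ _ _ (AllNE _ _ _ #0%term Hx) (le_refl _ _)) as H.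
    rewrite subst_at with (m := 2) in H by reflexivity.
    refine (ImpE _ _ _ _ _ H).
    assert (Hstep : prv V0 G' (AllN (at_ A 3 #0 ==> at_ A 3 (#0 + 1)))).
    { apply Hyp; do 4 right; left. cbn.
      rewrite !subst_at with (m := 3) by reflexivity. reflexivity. }
    pose proof (AllNE _ _ _ #0%term Hstep) as H1.
    unfold instN in H1; cbn in H1.
    rewrite !subst_at with (m := 2) in H1 by reflexivity. exact H1. }
  (* Either [x + 1] is [b], where [A] fails, or it lies below [b] and enters the set, and then L1
     makes it smaller than the length [x + 1]. *)
  apply le_cases with (1 := Hle).
  - apply ImpE with (at_ A 2 #1).
    + apply Hyp; do 3 right; left. unfold shiftN; cbn.
      rewrite subst_at with (m := 2) by reflexivity. reflexivity.
    + apply eq_at with (#0 + 1)%term; [hyp | apply prv_weaken1, Hsucc].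
  - apply lt_irrefl with (#0 + 1)%term.
    apply eq_lt_r with (Len 0); [apply prv_weaken1, eq_sym, Hlen |].
    apply ImpE with (1 := basic_inst _ _ 0%term (#0 + 1)%term 0 L1).
    set (D := _ :: _).
    assert (HD : forall B, prv V0 G' B -> prv V0 D B)
      by (intros; apply prv_weaken1; assumption).
    assert (H : prv V0 D (#0 + 1 < #1)%form) by hyp.
    apply ImpE with (1 := HD _ (Hinst (#0 + 1)%term)) in H.
    apply ImpE with (1 := AndE2 _ _ _ _ H).
    apply prv_cuts with (1 := AllLe_at_succ A 2 #0).
    intros B [<- | [<- | []]]; apply HD; assumption.
Qed.

Lemma V0_induction G A t :
  Sigma0B A ->
  prv V0 G (instN 0 A) ->
  prv V0 G (AllN (A ==> subst (scons (#0 + 1)%term (fun i => Var (S i)))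
                          (fun X => X) A)) ->
  prv V0 G (instN t A).
Proof.
  intros HA Hbase Hstep.
  (* Cutting the context down to the base case and the step yields the last two hypotheses of
     [induction_core]. *)
  apply AllNE. eapply prv_cuts with (D := [_; _]).
  2: { intros B [<- | [<- | []]]; [exact Hbase | exact Hstep]. }
  apply AllNI, RAA.
  (* Under the quantifier [y <= z] of [B], [#0] is [y], [#1] is [z] and [#2] is [b], so the ambient
     variables start at [#3]. *)
  pose (B := AllLe #0 (subst (scons #0%term (fun i => Var (3 + i)))
                         (fun X => X) A)).
  eapply ExSE with (B := Bot).
  { apply Ax, (V0_comp 0 B). apply Sigma0B_AllLe, Sigma0B_subst, HA. }
  match goal with |- prv _ ?G _ => apply (prv_weaken _ _ _ (induction_core A) G) end.
  intros C [<- | [<- | [<- | [<- | []]]]];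
    [left | do 1 right; left | do 2 right; left | do 3 right; left];
    unfold B, at_, AllLe, AllLt, Iff, Lt, instN, shiftN, shiftS, Not;
    cbn [subst tsubst tshiftS]; rewrite ?subst_subst;
    repeat match goal with
           | |- subst _ _ A = subst _ _ A => fail 1
           | |- _ => progress f_equal
           end;
    apply subst_ext; try reflexivity; intros [|i]; reflexivity.
Qed.

(** * Homomorphisms, colourings and images along two maps *)

(** [isHom] and [isColoring] are the conditions that [HOM] and [BIP] put on their witnessing strings
    beyond the length bounds. *)
Definition isHom (Z VG EG VH EH : nat) : form :=
  MAP (Len VG) (Len VH) Z
  /\ AllLt (Len VG) (AllLt (Len VG) (AllLt (Len VH) (AllLt (Len VH)
       (Rel EG #3 #2 /\ Rel Z #3 #1 /\ Rel Z #2 #0 ==> Rel EH #1 #0)))).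

Definition isColoring (W U V E : nat) : form :=
  AllLt (Len V) (Mem #0 W <==> ~ Mem #0 U)
  /\ AllLt (Len V) (AllLt #0
       (Rel E #0 #1 ==> (Mem #0 W /\ Mem #1 U) \/ (Mem #1 W /\ Mem #0 U))).

(* [u] is an image of [t] under [Z2] after [Z1]; the composite map itself would
   need inverses of the pairing function. *)
Definition path (Z1 Z2 V : nat) (t u : term) : form :=
  ExLt (Len V) (Rel Z1 (tshiftN t) #0 /\ Rel Z2 #0 (tshiftN u)).

Lemma path_total Z1 Z2 VC EC VG EG VH EH :
  prv V0 [isHom Z1 VC EC VG EG; isHom Z2 VG EG VH EH]
    (AllLt (Len VC) (ExLt (Len VH) (path Z1 Z2 VG #1 #0))).
Proof.
  apply AllNI, ImpI; cbn.
  have H (AllLt (Len VC) (ExLt (Len VG) (Rel Z1 #1 #0))).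
  inst H #0%term. discharge H. open_ex H.
  have H (AllLt (Len VG) (ExLt (Len VH) (Rel Z2 #1 #0))).
  inst H #0%term. discharge H. open_ex H.
  apply (ExNI _ _ _ #0%term), AndI; [conj_hyp |].
  apply (ExNI _ _ _ #1%term), AndI; [conj_hyp |].
  apply AndI; conj_hyp.
Qed.

Lemma path_edge Z1 Z2 VC EC VG EG VH EH :
  prv V0 [isHom Z1 VC EC VG EG; isHom Z2 VG EG VH EH]
    (AllLt (Len VC) (AllLt (Len VC) (AllLt (Len VH) (AllLt (Len VH)
       (Rel EC #3 #2 /\ path Z1 Z2 VG #3 #1 /\ path Z1 Z2 VG #2 #0
        ==> Rel EH #1 #0))))).
Proof.
  do 4 apply AllNI, ImpI. apply ImpI; cbn.
  have H (path Z1 Z2 VG #3 #1). open_ex H.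
  (* Opening the first path shifted the indices, so the same text now names the path from [i2] to
     [j2]. Afterwards the two middle vertices are [#1] and [#0]. *)
  have H (path Z1 Z2 VG #3 #1). open_ex H.
  have H1 (AllLt (Len VC) (AllLt (Len VC) (AllLt (Len VG) (AllLt (Len VG)
             (Rel EC #3 #2 /\ Rel Z1 #3 #1 /\ Rel Z1 #2 #0 ==> Rel EG #1 #0))))).
  inst H1 #5%term. discharge H1. inst H1 #4%term. discharge H1.
  inst H1 #1%term. discharge H1. inst H1 #0%term. discharge H1.
  discharge H1; [repeat apply AndI; conj_hyp |].
  have H2 (AllLt (Len VG) (AllLt (Len VG) (AllLt (Len VH) (AllLt (Len VH)
             (Rel EG #3 #2 /\ Rel Z2 #3 #1 /\ Rel Z2 #2 #0 ==> Rel EH #1 #0))))).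
  inst H2 #1%term. discharge H2. inst H2 #0%term. discharge H2.
  inst H2 #3%term. discharge H2. inst H2 #2%term. discharge H2.
  discharge H2; [apply AndI; [exact H1 |]; apply AndI; conj_hyp |].
  exact H2.
Qed.

Lemma isColoring_lt_edge W U V E :
  prv V0 [isColoring W U V E]
    (AllLt (Len V) (AllLt (Len V)
       (#0 < #1 ==> Rel E #0 #1 ==> (Mem #0 W <==> ~ Mem #1 W)))).
Proof.
  do 2 apply AllNI, ImpI. do 2 apply ImpI; cbn.
  have HW (AllLt (Len V) (Mem #0 W <==> ~ Mem #0 U)). pose proof HW as HW'.
  inst HW #0%term. discharge HW. inst HW' #1%term. discharge HW'.
  apply Iff_not_of_split with (1 := HW) (2 := HW').
  have H (AllLt (Len V) (AllLt #0
       (Rel E #0 #1 ==> (Mem #0 W /\ Mem #1 U) \/ (Mem #1 W /\ Mem #0 U)))).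
  inst H #1%term. discharge H. inst H #0%term. discharge H. discharge H.
  exact H.
Qed.

(** The colouring clause speaks only of pairs [i < j]. Symmetry of the edge relation covers the
    other order, and the absence of loops excludes [i = j]. *)
Lemma isColoring_edge W U V E :
  prv V0 [GRAPH V E; isColoring W U V E]
    (AllLt (Len V) (AllLt (Len V)
       (Rel E #1 #0 ==> (Mem #1 W <==> ~ Mem #0 W)))).
Proof.
  eapply prv_cut.
  { eapply prv_weaken; [apply (isColoring_lt_edge W U V E) |].
    incl_ctx. }
  do 2 apply AllNI, ImpI. apply ImpI; cbn.
  apply lt_trichotomy with #0%term #1%term.
  - apply Iff_not_sym.
    have H (AllLt (Len V) (AllLt (Len V)
       (#0 < #1 ==> Rel E #0 #1 ==> (Mem #0 W <==> ~ Mem #1 W)))).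
    inst H #1%term. discharge H. inst H #0%term. discharge H. discharge H.
    discharge H; [| exact H].
    have Hsym (AllLt (Len V) (AllLt #0 (Rel E #0 #1 <==> Rel E #1 #0))).
    inst Hsym #1%term. discharge Hsym. inst Hsym #0%term. discharge Hsym.
    apply ImpE with (1 := AndE2 _ _ _ _ Hsym). hyp.
  - apply prv_exfalso.
    have Hirr (AllLt (Len V) (~ Rel E #0 #0)).
    inst Hirr #1%term. discharge Hirr. apply ImpE with (1 := Hirr).
    apply (EqNSubst _ _ (Rel E #2 #0) #0 #1); hyp.
  - have H (AllLt (Len V) (AllLt (Len V)
       (#0 < #1 ==> Rel E #0 #1 ==> (Mem #0 W <==> ~ Mem #1 W)))).
    inst H #0%term. discharge H. inst H #1%term. discharge H. discharge H.
    discharge H. exact H.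
Qed.

(** * Alternating colours along the odd cycle *)

Section Alternation.
Variables W U Z1 Z2 VC EC VG EG VH EH : nat.

Let chain : list form :=
  [GRAPH VH EH; isColoring W U VH EH;
   isHom Z1 VC EC VG EG; isHom Z2 VG EG VH EH].

Lemma path_edge_alternates :
  prv V0 chain
    (AllLt (Len VC) (AllLt (Len VC) (AllLt (Len VH) (AllLt (Len VH)
       (Rel EC #3 #2 /\ path Z1 Z2 VG #3 #1 /\ path Z1 Z2 VG #2 #0
        ==> (Mem #1 W <==> ~ Mem #0 W)))))).
Proof.
  eapply prv_cut.
  { eapply prv_weaken; [apply (path_edge Z1 Z2 VC EC VG EG VH EH) |].
    incl_ctx. }
  eapply prv_cut.
  { eapply prv_weaken; [apply (isColoring_edge W U VH EH) |].
    incl_ctx. }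
  do 4 apply AllNI, ImpI. apply ImpI; cbn.
  have H (AllLt (Len VC) (AllLt (Len VC) (AllLt (Len VH) (AllLt (Len VH)
       (Rel EC #3 #2 /\ path Z1 Z2 VG #3 #1 /\ path Z1 Z2 VG #2 #0
        ==> Rel EH #1 #0))))).
  inst H #3%term. discharge H. inst H #2%term. discharge H.
  inst H #1%term. discharge H. inst H #0%term. discharge H. discharge H.
  have H1 (AllLt (Len VH) (AllLt (Len VH)
             (Rel EH #1 #0 ==> (Mem #1 W <==> ~ Mem #0 W)))).
  inst H1 #1%term. discharge H1. inst H1 #0%term. discharge H1.
  discharge H1; [exact H | exact H1].
Qed.

(* The free [#0] is [k - 1]. *)
Lemma path_step :
  prv V0 ([(#0 + 1 = Len VC)%form; AllLt #0 (Rel EC #0 (#0 + 1))] ++ chain)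
    (AllLt #0 (AllLt (Len VH) (path Z1 Z2 VG #1 #0 ==>
       ExLt (Len VH) (path Z1 Z2 VG (#2 + 1) #0 /\ (Mem #1 W <==> ~ Mem #0 W))))).
Proof.
  eapply prv_cut.
  { eapply prv_weaken; [apply path_edge_alternates |].
    incl_ctx. }
  eapply prv_cut.
  { eapply prv_weaken; [apply (path_total Z1 Z2 VC EC VG EG VH EH) |].
    incl_ctx. }
  do 2 apply AllNI, ImpI. apply ImpI; cbn.
  (* From [i < k - 1] both [i] and [i + 1] are vertices of the cycle; totality at [i + 1] supplies
     the new image. *)
  eapply prv_cut with (#1 < Len VC)%form.
  { apply eq_lt_r with (#2 + 1)%term; [conj_hyp |].
    apply lt_succ_of_le; conj_hyp. }
  eapply prv_cut with (#1 + 1 < Len VC)%form.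
  { apply eq_lt_r with (#2 + 1)%term; [conj_hyp |].
    apply lt_succ_of_le, succ_le_of_lt; conj_hyp. }
  have H (AllLt (Len VC) (ExLt (Len VH) (path Z1 Z2 VG #1 #0))).
  inst H (#1 + 1)%term. discharge H. open_ex H.
  apply (ExNI _ _ _ #0%term), AndI; [conj_hyp |].
  apply AndI; [conj_hyp |].
  have H (AllLt (Len VC) (AllLt (Len VC) (AllLt (Len VH) (AllLt (Len VH)
       (Rel EC #3 #2 /\ path Z1 Z2 VG #3 #1 /\ path Z1 Z2 VG #2 #0
        ==> (Mem #1 W <==> ~ Mem #0 W)))))).
  inst H #2%term. discharge H. inst H (#2 + 1)%term. discharge H.
  inst H #1%term. discharge H. inst H #0%term. discharge H.
  discharge H; [| exact H].
  apply AndI; [| apply AndI; conj_hyp].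
  have H1 (AllLt #3 (Rel EC #0 (#0 + 1))).
  inst H1 #2%term. discharge H1. exact H1.
Qed.

Lemma odd_cycle_absurd :
  prv V0 ([divides 2 #0; Rel EC 0 #0;
           (#0 + 1 = Len VC)%form; AllLt #0 (Rel EC #0 (#0 + 1))] ++ chain)
    Bot.
Proof.
  eapply prv_cut; [eapply prv_weaken;
    [apply (path_total Z1 Z2 VC EC VG EG VH EH) | incl_ctx] |].
  eapply prv_cut; [eapply prv_weaken; [apply path_step | incl_ctx] |].
  eapply prv_cut; [eapply prv_weaken; [apply path_edge_alternates | incl_ctx] |].
  cbn. eapply prv_cut with (0 < Len VC)%form.
  { apply eq_lt_r with (#0 + 1)%term; [conj_hyp |].
    apply lt_succ_of_le. exact (basic_inst _ _ #0%term 0%term 0 B9). }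
  eapply prv_cut with (#0 < Len VC)%form.
  { apply eq_lt_r with (#0 + 1)%term; [conj_hyp |].
    apply lt_succ_of_le, le_refl. }
  have H (AllLt (Len VC) (ExLt (Len VH) (path Z1 Z2 VG #1 #0))).
  inst H 0%term. discharge H. open_ex H.
  (* The witness [h] with [2 * h = k - 1] becomes [#0], next to [l0] at [#1] and [k - 1] at [#2].
     The induction claim on [q] is taken at [q = h]. *)
  have Hdiv (divides 2 #1). open_ex Hdiv.
  lazymatch goal with |- prv _ ?G _ => assert (H : prv V0 G
     (2 * #0 <= #2 ==> ExLt (Len VH)
       (path Z1 Z2 VG (2 * #1) #0 /\ (Mem #2 W <==> Mem #0 W)))) end.
  { apply (V0_induction _ (2 * #0 <= #3 ==> ExLt (Len VH)
       (path Z1 Z2 VG (2 * #1) #0 /\ (Mem #3 W <==> Mem #0 W))) #0).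
    - unfold path, Rel, Iff. repeat constructor.
    - cbn. apply ImpI. apply (ExNI _ _ _ #1%term), AndI; [conj_hyp |].
      apply AndI.
      + apply (EqNSubst _ _ (path Z1 Z2 VG #0 #2) 0 (2 * 0)).
        * apply eq_sym. exact (basic_inst _ _ 2%term 0%term 0 B5).
        * conj_hyp.
      + apply AndI; apply ImpI; hyp.
    - apply AllNI; cbn. do 2 apply ImpI.
      (* [2] is the term [1 + 1], so after B6 an instance of B4 regroups the sum. *)
      apply prv_cut with (2 * (#0 + 1) = 2 * #0 + 1 + 1)%form.
      { apply eq_trans with (2 * #0 + 2)%term.
        - exact (basic_inst _ _ 2%term #0%term 0 B6).
        - exact (basic_inst _ _ (2 * #0)%term 1%term 0 B4). }
      apply prv_cut with (2 * #0 + 1 < #3)%form.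
      { apply lt_of_succ_le, eq_le_l with (2 * (#0 + 1))%term; conj_hyp. }
      apply prv_cut with (2 * #0 < #3)%form.
      { apply lt_of_succ_le. conj_hyp. }
      have H (2 * #0 <= #3 ==> ExLt (Len VH)
               (path Z1 Z2 VG (2 * #1) #0 /\ (Mem #3 W <==> Mem #0 W)))%form.
      discharge H. open_ex H.
      (* Two uses of [path_step] lead from an image of [2 * q] through one of [2 * q + 1] to one of
         [2 * q + 2], with two colour changes. *)
      have H (AllLt #4 (AllLt (Len VH) (path Z1 Z2 VG #1 #0 ==>
         ExLt (Len VH)
           (path Z1 Z2 VG (#2 + 1) #0 /\ (Mem #1 W <==> ~ Mem #0 W))))).
      inst H (2 * #1)%term. discharge H. inst H #0%term. discharge H.
      discharge H. open_ex H.
      have H (AllLt #5 (AllLt (Len VH) (path Z1 Z2 VG #1 #0 ==>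
         ExLt (Len VH)
           (path Z1 Z2 VG (#2 + 1) #0 /\ (Mem #1 W <==> ~ Mem #0 W))))).
      inst H (2 * #2 + 1)%term. discharge H. inst H #0%term. discharge H.
      discharge H. open_ex H.
      apply (ExNI _ _ _ #0%term), AndI; [conj_hyp |]. apply AndI.
      + apply (EqNSubst _ _ (path Z1 Z2 VG #0 #1)
                 (2 * #3 + 1 + 1) (2 * (#3 + 1))).
        * apply eq_sym; conj_hyp.
        * conj_hyp.
      + apply Iff_trans with (Mem #2 W); [conj_hyp |].
        apply Iff_not_trans with (Mem #1 W); conj_hyp. }
  discharge H.
  { apply eq_le_l with #2%term; [apply eq_sym; conj_hyp | apply le_refl]. }
  open_ex H.
  (* The closing edge [(0, k - 1)] forces [l0] and the image found at [2 * h = k - 1] to differ in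
     colour, against the induction claim. *)
  have H (AllLt (Len VC) (AllLt (Len VC) (AllLt (Len VH) (AllLt (Len VH)
       (Rel EC #3 #2 /\ path Z1 Z2 VG #3 #1 /\ path Z1 Z2 VG #2 #0
        ==> (Mem #1 W <==> ~ Mem #0 W)))))).
  inst H 0%term. discharge H. inst H #3%term. discharge H.
  inst H #2%term. discharge H. inst H #0%term. discharge H.
  discharge H.
  { apply AndI; [conj_hyp |]. apply AndI; [conj_hyp |].
    apply (EqNSubst _ _ (path Z1 Z2 VG #0 #1) (2 * #1) #3); conj_hyp. }
  apply Iff_not_absurd with (Mem #2 W) (Mem #0 W); [conj_hyp |].
  apply Iff_not_sym, H.
Qed.

(** Binds [k - 1] and moves the conditions on it into the formula, so that only [chain] has to be
    derived where this is applied. *)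
Lemma no_odd_cycle :
  prv V0 chain
    (AllN (AllLt #0 (Rel EC #0 (#0 + 1)) ==> #0 + 1 = Len VC ==>
           Rel EC 0 #0 ==> divides 2 #0 ==> Bot)).
Proof.
  (* The formulas of [chain] have no free number variables, so the shift leaves them unchanged. *)
  apply AllNI. change (map shiftN chain) with chain. do 4 apply ImpI.
  eapply prv_weaken; [apply odd_cycle_absurd | incl_ctx].
Qed.

End Alternation.

(** * Opening the hypotheses on [G] and [H] and applying the cycle argument *)

(* Inside the two quantifiers, G is the pair (3, 2) and H is the pair (1, 0). *)
Theorem theorem2 :
  provable V0
    (AllGraph (AllGraph (BIP 1 0 /\ NONBIP 3 2 ==> ~ HOM 3 2 1 0)%form)).
Proof.
  do 2 (do 2 apply AllSI; apply ImpI). do 2 apply ImpI. cbn.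
  (* After opening all quantifiers the strings are Z1 = 0, EC = 1, VC = 2, U = 3,
     W = 4, Z2 = 5, EH = 6, VH = 7, EG = 8, VG = 9, and the numbers are k = #4
     and the two copies #3 (from [divides]) and #2 (from [CYCLE]) of k - 1. *)
  have H (HOM 3 2 1 0). open_ex H. head_conj H. open_ex H. head_conj H. open_exS H.
  have H (BIP 2 1). open_exS H.
  head_conj H. open_exS H.
  have H (NONBIP 6 5). open_ex H.
  have H (LetPred #0 (divides 2 #0)). open_ex H.
  have H (ExS (Len 0 = #1 /\ ExS (Len 0 < 4 * (#1 * #1)
                 /\ CYCLE 1 0 /\ HOM 1 0 8 7))). open_exS H.
  have H (ExS (Len 0 < 4 * (#1 * #1) /\ CYCLE 1 0 /\ HOM 1 0 8 7)). open_exS H.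
  have H (CYCLE 1 0). open_ex H.
  have H (HOM 1 0 8 7). open_ex H. head_conj H. open_ex H. head_conj H. open_exS H.
  (* For [k = 0] the length of the cycle's edge string would be below [4 * (0 * 0) = 0]. Excluding
     this rules out the default [0 - 1 = 0] in both predecessors of [k]. *)
  apply prv_cut with (#4 <> 0)%form.
  { apply ImpI. apply lt_0_absurd with (Len 1).
    apply eq_lt_r with (4 * (#4 * #4))%term; [| conj_hyp].
    apply (EqNSubst _ _ (4 * (#0 * #0) = 0)%form 0 #4); [apply eq_sym; hyp |].
    apply (EqNSubst _ _ (4 * #0 = 0)%form 0 (0 * 0)).
    - apply eq_sym. exact (basic_inst _ _ 0%term 0%term 0 B5).
    - exact (basic_inst _ _ 4%term 0%term 0 B5). }
  have Hlen (Len 2 = #4)%form.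
  lazymatch goal with |- prv _ ?G _ =>
    assert (Hpred1 : prv V0 G (#3 + 1 = #4)%form);
    [| assert (Hpred2 : prv V0 G (#2 + 1 = Len 2)%form)] end.
  { have H (#3 + 1 = #4 \/ (#4 = 0 /\ #3 = 0))%form.
    eapply OrE with (1 := H); [hyp |].
    apply prv_exfalso, ImpE with (#4 = 0)%form; conj_hyp. }
  { have H (#2 + 1 = Len 2 \/ (Len 2 = 0 /\ #2 = 0))%form.
    eapply OrE with (1 := H); [hyp |].
    apply prv_exfalso, ImpE with (#4 = 0)%form; [conj_hyp |].
    apply eq_trans with (Len 2); [apply eq_sym; conj_hyp | conj_hyp]. }
  (* Divisibility is known for the copy [#3] of [k - 1]; injectivity of successor, B2, carries it
     over to the copy [#2] used by the cycle edges. *)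
  lazymatch goal with |- prv _ ?G _ =>
    assert (H : prv V0 G (divides 2 #2)) end.
  { apply (EqNSubst _ _ (divides 2 #0) #3 #2); [| conj_hyp].
    refine (ImpE _ _ _ _ (basic_inst _ _ #3%term #2%term 0 B2) _).
    apply eq_trans with #4%term; [exact Hpred1 |].
    apply eq_trans with (Len 2); [apply eq_sym, Hlen | apply eq_sym, Hpred2]. }
  lazymatch goal with |- prv _ ?G _ =>
    assert (Hno : prv V0 G
      (AllN (AllLt #0 (Rel 1 #0 (#0 + 1)) ==> #0 + 1 = Len 2 ==>
             Rel 1 0 #0 ==> divides 2 #0 ==> Bot))) end.
  { eapply prv_cuts; [apply (no_odd_cycle 4 3 0 5 2 1 9 8 7 6) |].
    (* In order: [H] is a graph, its colouring, the map from the cycle to [G], and the map from [G]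
       to [H]. *)
    intros B [<- | [<- | [<- | [<- | []]]]].
    - conj_hyp.
    - unfold isColoring; apply AndI; conj_hyp.
    - unfold isHom; apply AndI; conj_hyp.
    - unfold isHom; apply AndI; conj_hyp. }
  inst Hno #2%term. discharge Hno. discharge Hno; [exact Hpred2 |].
  discharge Hno. discharge Hno; [exact H | exact Hno].
Qed.
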